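(* Let $a,c\in\mathbb R$ with $a^2>c^2$, let $K,\varepsilon_0,h_0>0$, and assume there is $\gamma>0$ with $|\zeta(\varepsilon,i\kappa)|\ge\gamma$ for all real $\kappa$ with $|\kappa|\le K$ and all $0\le\varepsilon\le\varepsilon_0$. Then for $|\kappa|\le K$, $0<\varepsilon\le\varepsilon_0$ and $0<h\le h_0$ there is a constant $C$, independent of $h$ and $\varepsilon$, such that $$\bigl|q(h,\varepsilon,i\kappa)-e^{h\lambda_s(\varepsilon,i\kappa)}\bigr|\le Ch^5,$$ where $q$ is the projected amplification factor determined by $\Pi_sS_\varepsilon\Pi_s=q\,\Pi_s$. Consequently $$\bigl\|\Pi_sS_\varepsilon\Pi_s-e^{hL_\varepsilon}\Pi_s\bigr\|\le Ch^5$$ with a possibly larger constant independent of $h$ and $\varepsilon$.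
   Context: Jin–Xin Fourier block with $d=i\kappa$: $$A=\begin{pmatrix}0&-d\\-a^2d&0\end{pmatrix},\quad B=\frac1\varepsilon\begin{pmatrix}0&0\\c&-1\end{pmatrix},\quad L_\varepsilon=A+B.$$ $\zeta(\varepsilon,d)=\sqrt{1-4\varepsilon cd+4\varepsilon^2a^2d^2}$, the branch continuous in $\varepsilon$ with $\zeta(0,d)=1$. The slow eigenvalue, a root of $\varepsilon\lambda^2+\lambda+cd-\varepsilon a^2d^2=0$, is $$\lambda_s(\varepsilon,d)=\frac{2(\varepsilon a^2d^2-cd)}{1+\zeta(\varepsilon,d)},$$ and the rank-one slow spectral projector of $L_\varepsilon$ is $$\Pi_s=\frac1\zeta\begin{pmatrix}1+\varepsilon\lambda_s&-\varepsilon d\\c-\varepsilon a^2d&\varepsilon\lambda_s\end{pmatrix}.$$ The base step is $S_\varepsilon=S(h;A,B)$ where, with $L=A+B$, $$P_*=\Bigl(I-\tfrac h2B+\tfrac{h^2}{8}BL\Bigr)^{-1}\Bigl(I+\tfrac h2A+\tfrac{h^2}{8}AL\Bigr),$$ $$S(h;A,B)=\Bigl(I-hB+\tfrac{h^2}{6}BL\Bigr)^{-1}\Bigl[I+hA+\tfrac{h^2}{6}AL+\tfrac{h^2}{3}(A-B)LP_*\Bigr].$$ The constant $C$ may depend on $a,c,K,\varepsilon_0,h_0,\gamma$ and the fixed matrix norm, and is uniform over $|\kappa|\le K$. *)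

(* Defs.v *)
From HB Require Import structures.
From mathcomp Require Import all_boot all_order all_algebra.
From mathcomp Require Import all_classical all_reals all_analysis.
From mathcomp Require Import complex.

Set Implicit Arguments.
Unset Strict Implicit.
Unset Printing Implicit Defensive.

Import Order.TTheory GRing.Theory Num.Theory numFieldNormedType.Exports.
Local Open Scope classical_set_scope.
Local Open Scope ring_scope.
Local Open Scope complex_scope.

(* R[i] gets the topology of its modulus; 'M[R[i]]_n then gets the entrywise
   (sup norm) topology. *)
HB.instance Definition _ (R : rcfType) := NormedModule.copy R[i] R[i]^o.

Definition cexp (R : realType) (z : R[i]) : R[i] :=
  limn (series (fun k : nat => z ^+ k / k`!%:R)).

Definition mexp (R : realType) (n : nat) (M : 'M[R[i]]_n.+1) : 'M[R[i]]_n.+1 :=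
  limn (series (fun k : nat => k`!%:R^-1 *: M ^+ k)).

Record matrix_norm (R : realType) (n : nat) (N : 'M[R[i]]_n -> R) : Prop := {
  matrix_norm_eq0 : forall M, N M = 0 -> M = 0;
  matrix_normZ : forall z M, (N (z *: M))%:C = `|z| * (N M)%:C;
  matrix_normD : forall M1 M2, N (M1 + M2) <= N M1 + N M2 }.

(* In the ring 'M_n.+1, the inverse X^-1 is invmx X, which is X itself when X is
   singular.  For the Jin-Xin block below with d imaginary and eps, h > 0, both
   inverted matrices are lower triangular with diagonal entries of real part
   >= 1, so these are genuine inverses. *)
Section Step.
Variables (F : fieldType) (n : nat).
Implicit Types (h : F) (A B : 'M[F]_n.+1).

Definition step_half h A B : 'M[F]_n.+1 :=
  let L := A + B in
  (1 - (h / 2) *: B + (h ^+ 2 / 8) *: (B * L))^-1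
  * (1 + (h / 2) *: A + (h ^+ 2 / 8) *: (A * L)).

Definition step h A B : 'M[F]_n.+1 :=
  let L := A + B in
  (1 - h *: B + (h ^+ 2 / 6) *: (B * L))^-1
  * (1 + h *: A + (h ^+ 2 / 6) *: (A * L)
     + (h ^+ 2 / 3) *: ((A - B) * L * step_half h A B)).

End Step.

Definition mx2 (F : Type) (x00 x01 x10 x11 : F) : 'M[F]_2 :=
  \matrix_(i < 2, j < 2)
    if i == 0 then (if j == 0 then x00 else x01)
    else (if j == 0 then x10 else x11).

Section JinXin.
Variable R : realType.
Implicit Types (a c eps h K : R) (d z : R[i]).

Definition jxA a d : 'M[R[i]]_2 := mx2 0 (- d) (- (a%:C ^+ 2 * d)) 0.

Definition jxB c eps : 'M[R[i]]_2 := (eps%:C)^-1 *: mx2 0 0 c%:C (- 1).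

Definition jxL a c eps d : 'M[R[i]]_2 := jxA a d + jxB c eps.

Definition jxS a c h eps d : 'M[R[i]]_2 := step h%:C (jxA a d) (jxB c eps).

(* zeta is the branch of sqrt (1 - 4 eps c d + 4 eps^2 a^2 d^2), at d = i kappa
   with |kappa| <= K, that is continuous in eps on [0, eps0] and equals 1 at
   eps = 0. *)
Definition zeta_branch a c K (eps0 : R) (zeta : R -> R[i] -> R[i]) : Prop :=
  forall kappa : R, `|kappa| <= K ->
    let d := 'i%C * kappa%:C in
    [/\ {within `[0, eps0], continuous (fun eps => zeta eps d)},
        zeta 0 d = 1 &
        forall eps, 0 <= eps <= eps0 ->
          zeta eps d ^+ 2 = 1 - 4 * eps%:C * c%:C * d
                            + 4 * eps%:C ^+ 2 * a%:C ^+ 2 * d ^+ 2].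

(* Below, z stands for the value of zeta at (eps, d). *)
Definition lambda_s a c eps d z : R[i] :=
  2 * (eps%:C * a%:C ^+ 2 * d ^+ 2 - c%:C * d) / (1 + z).

Definition Pi_s a c eps d z : 'M[R[i]]_2 :=
  let el := eps%:C * lambda_s a c eps d z in
  z^-1 *: mx2 (1 + el) (- (eps%:C * d))
              (c%:C - eps%:C * a%:C ^+ 2 * d) el.

End JinXin.

(* Main.v *)
Require Import Defs.
From HB Require Import structures.
From mathcomp Require Import all_boot all_order all_algebra.
From mathcomp Require Import all_classical all_reals all_analysis.
From mathcomp Require Import complex ring lra.

Set Implicit Arguments.
Unset Strict Implicit.
Unset Printing Implicit Defensive.

Import Order.TTheory GRing.Theory Num.Theory numFieldNormedType.Exports.
Local Open Scope classical_set_scope.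
Local Open Scope ring_scope.
Local Open Scope complex_scope.

(** Let [L = A + B], let [E] and [D] be the matrices inverted in the half stage
    and in the final stage of the step, and put [l = lambda_s], [x = h l].  On the
    range of [Pi = Pi_s] the matrix [L] acts as [l], hence [A] acts as [l - B],
    and both stages applied to [Pi] involve only [Pi] and [B Pi].  The
    coefficients of the scheme make all the low order terms cancel identically
    ([step_half_eigen], [step_eigen]): with [T4] the Taylor polynomial of degree 4
    of the exponential,

      [S Pi = T4(x) Pi + h^5 l^4 (1/72 - x/144) D^-1 B Pi
              - (h^6 l^3 / 192) D^-1 (A - B) L E^-1 B Pi].

    This is exact, so the ratio [h / eps] never has to be small.  After
    multiplication by [Pi] on the left each remainder is a multiple of [Pi]
    ([Pi_s_step]), and what is left is to bound the two multiples by [h^5]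
    uniformly in [eps] ([jx_q_taylor]).  Three facts make this possible.

    - [B Pi = l Pi - A Pi] is bounded although [B] is of size [1 / eps].
    - [E] and [D] are lower triangular with upper diagonal entry 1.  As [d] is
      imaginary, their lower diagonal entries have real parts
      [1 + h/(2 eps) + h^2/(8 eps^2)] and [1 + h/eps + h^2/(6 eps^2)].  Since [B Pi]
      only has a second row, [E^-1] divides it by the first of these, which
      is at least [h / (2 eps)] and turns [h^6] into [2 eps h^5].
    - The remaining factor [D^-1 (A - B) L] costs [1 / eps] in the first component
      and [1 / eps^2] in the second one, but the row vector of [Pi] weights the
      second component by [eps].  The total cost [1 / eps] is paid by the factor
      [2 eps] just gained.

    The eigenvalue [l] is bounded because [1 + zeta] stays away from 0: the real
    part of [zeta] starts at 1 and never vanishes ([zeta_Re_gt0]).  Therefore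
    [T4(x)] is within [O(h^5)] of the exponential ([cexp_taylor4]).  For the matrix
    estimate, [L] is [l] on the range of [Pi] and another scalar on the range of
    [1 - Pi], so its exponential is computed spectrally ([mexp_spectral]); the
    error is then a scalar of size [O(h^5)] times the bounded matrix [Pi]. *)

Local Notation Re := complex.Re.
Local Notation Im := complex.Im.

(** * The modulus of a complex number as a real number *)

Section Modulus.
Variable R : rcfType.
Implicit Types (z : R[i]) (x : R).

(** The norm of [R[i]] takes values in [R[i]], whose order is only partial; the
    estimates are carried out in [R], where the order is total. *)
Definition modulus z : R := Re `|z|.

Lemma modulusE z : `|z| = (modulus z)%:C.
Proof. by rewrite RRe_real // normr_real. Qed.

Lemma modulus_ge0 z : 0 <= modulus z.
Proof. by rewrite -ler0c -modulusE. Qed.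

Lemma modulusM z1 z2 : modulus (z1 * z2) = modulus z1 * modulus z2.
Proof. by apply: complexI; rewrite rmorphM -!modulusE normrM. Qed.

Lemma modulusV z : modulus z^-1 = (modulus z)^-1.
Proof. by apply: complexI; rewrite fmorphV -!modulusE normfV. Qed.

Lemma modulus_i : modulus 'i%C = 1.
Proof. by rewrite /modulus normc_def /= expr0n expr1n add0r sqrtr1. Qed.

Lemma modulus_real x : modulus x%:C = `|x|.
Proof.
by apply: complexI; rewrite -modulusE normc_def /= expr0n addr0 sqrtr_sqr.
Qed.

Lemma modulusX z k : modulus (z ^+ k) = modulus z ^+ k.
Proof. by apply: complexI; rewrite -modulusE normrX modulusE rmorphXn. Qed.

Lemma modulus_nat k : modulus (k%:R : R[i]) = k%:R.
Proof. by apply: complexI; rewrite -modulusE normr_nat rmorph_nat. Qed.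

Lemma ler_modulusD z1 z2 : modulus (z1 + z2) <= modulus z1 + modulus z2.
Proof. by rewrite -lecR rmorphD -!modulusE ler_normD. Qed.

Lemma modulusN z : modulus (- z) = modulus z.
Proof. by apply: complexI; rewrite -!modulusE normrN. Qed.

Lemma ler_modulusB z1 z2 : modulus (z1 - z2) <= modulus z1 + modulus z2.
Proof. by rewrite -(modulusN z2) ler_modulusD. Qed.

Lemma modulus_sum I (s : seq I) (u : I -> R[i]) :
  modulus (\sum_(i <- s) u i) <= \sum_(i <- s) modulus (u i).
Proof.
by rewrite -lecR rmorph_sum -modulusE ler_norm_sum.
Qed.

Lemma ler_Re_modulus z : `|Re z| <= modulus z.
Proof. by rewrite -lecR; exact: normc_ge_Re. Qed.

Lemma ler_Im_modulus z : `|Im z| <= modulus z.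
Proof.
have := ler_Re_modulus (z * 'i%C); rewrite ReiNIm normrN modulusM.
by rewrite modulus_i mulr1.
Qed.

Lemma modulus_le_ReIm z : modulus z <= `|Re z| + `|Im z|.
Proof.
rewrite {1}(complexE z) (le_trans (ler_modulusD _ _)) // modulusM !modulus_real.
by rewrite modulus_i mul1r.
Qed.

Lemma ReD z1 z2 : Re (z1 + z2) = Re z1 + Re z2.
Proof. by case: z1 z2 => ? ? []. Qed.

Lemma ImD z1 z2 : Im (z1 + z2) = Im z1 + Im z2.
Proof. by case: z1 z2 => ? ? []. Qed.

Lemma Re_sum I (s : seq I) (u : I -> R[i]) :
  Re (\sum_(i <- s) u i) = \sum_(i <- s) Re (u i).
Proof. exact: (big_morph _ ReD). Qed.

Lemma Im_sum I (s : seq I) (u : I -> R[i]) :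
  Im (\sum_(i <- s) u i) = \sum_(i <- s) Im (u i).
Proof. exact: (big_morph _ ImD). Qed.

End Modulus.

(** * The complex exponential and its Taylor remainder *)

Section ComplexExponential.
Variable R : realType.
Implicit Types (z : R[i]) (u : nat -> R[i]).

Lemma cvg_ReIm u (x y : R) :
  Re (u n) @[n --> \oo] --> x -> Im (u n) @[n --> \oo] --> y ->
  u n @[n --> \oo] --> x +i* y.
Proof.
move=> /cvgrPdist_lt ux /cvgrPdist_lt uy; apply/cvgrPdist_lt => -[e e'].
rewrite ltcE /= => /andP[/eqP -> e0].
have e20 : 0 < e / 2 by rewrite divr_gt0.
near=> n; rewrite modulusE ltcR (le_lt_trans (modulus_le_ReIm _)) //.
rewrite !ReD !ImD (splitr e) ltrD //.
  have -> : Re (- u n) = - Re (u n) by case: (u n).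
  by near: n; exact: ux.
have -> : Im (- u n) = - Im (u n) by case: (u n).
by near: n; exact: uy.
Unshelve. all: by end_near. Qed.

Lemma modulus_exp_coeff z k :
  modulus (z ^+ k / k`!%:R) = exp_coeff (modulus z) k.
Proof. by rewrite modulusM modulusV modulusX modulus_nat. Qed.

(** Convergence in [R[i]] is reduced to that of the real and imaginary parts, for
    which this comparison with the real exponential series is available. *)
Lemma is_cvg_dominated_exp (f : nat -> R) (x : R) :
  (forall k, `|f k| <= exp_coeff x k) -> cvgn (series f).
Proof.
move=> fx; apply: normed_cvg; apply: (series_le_cvg _ _ fx).
- by move=> k; exact: normr_ge0.
- by move=> k; apply: le_trans (fx k); exact: normr_ge0.
- exact: is_cvg_series_exp_coeff.
Qed.

Lemma cvg_cexp z : series (fun k => z ^+ k / k`!%:R) n @[n --> \oo] --> cexp z.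
Proof.
set v := fun k => z ^+ k / k`!%:R.
have cRe : cvgn (series (fun k => Re (v k))).
  apply: (@is_cvg_dominated_exp _ (modulus z)) => k.
  by rewrite -modulus_exp_coeff ler_Re_modulus.
have cIm : cvgn (series (fun k => Im (v k))).
  apply: (@is_cvg_dominated_exp _ (modulus z)) => k.
  by rewrite -modulus_exp_coeff ler_Im_modulus.
have : cvgn (series v).
  apply/cvg_ex; eexists; apply: cvg_ReIm.
    by under eq_fun do rewrite /series /= Re_sum; exact: cRe.
  by under eq_fun do rewrite /series /= Im_sum; exact: cIm.
by [].
Qed.

Lemma continuous_Re : continuous (@Re R).
Proof.
move=> z; apply/(cvgrPdist_lt (FF := nbhs_filter z)) => e e0.
have eC : 0 < e%:C :> R[i] by rewrite ltcR.
have : \forall w \near z, ball z e%:C w by exact: nbhsx_ballx.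
apply: filterS => w; rewrite -ball_normE /= modulusE ltcR; apply: le_lt_trans.
by rewrite (le_trans _ (ler_Re_modulus _)) // ReD; case: w.
Qed.

Definition exp_taylor4 (F : fieldType) (x : F) : F :=
  1 + x + x ^+ 2 / 2 + x ^+ 3 / 6 + x ^+ 4 / 24.

Lemma exp_taylor4_series (F : fieldType) (x : F) :
  exp_taylor4 x = \sum_(0 <= k < 5) x ^+ k / k`!%:R.
Proof.
by rewrite unlock /= /exp_taylor4 expr0 expr1 !divr1 addr0 !addrA.
Qed.

(** Shifting the index by 5 factors out [z ^+ 5], and [(k + 5)`!] is at least
    [k`!], so that the rest is below the full exponential series. *)
Lemma modulus_exp_tail z m :
  modulus (\sum_(5 <= k < m + 5) z ^+ k / k`!%:R)
    <= modulus z ^+ 5 * expR (modulus z).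
Proof.
rewrite -{1}(add0n 5%N) big_addn addnK (le_trans (modulus_sum _ _)) //.
apply: (@le_trans _ _
  (\sum_(0 <= k < m) modulus z ^+ 5 * exp_coeff (modulus z) k)).
  apply: ler_sum => k _; rewrite modulus_exp_coeff /exp_coeff /= exprD.
  rewrite [_ ^+ k * _]mulrC -mulrA ler_wpM2l ?exprn_ge0 ?modulus_ge0 //.
  rewrite ler_wpM2l ?exprn_ge0 ?modulus_ge0 //.
  rewrite lef_pV2 ?posrE ?ltr0n ?fact_gt0 //.
  by rewrite ler_nat leq_fact // leq_addr.
rewrite -mulr_sumr ler_wpM2l ?exprn_ge0 ?modulus_ge0 //.
apply: (@nondecreasing_cvgn_le _ (series (exp_coeff (modulus z)))).
  apply/nondecreasing_series => k _ _.
  by rewrite exp_coeff_ge0 // modulus_ge0.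
exact: is_cvg_series_exp_coeff.
Qed.

Lemma cexp_taylor4 z :
  modulus (cexp z - exp_taylor4 z) <= modulus z ^+ 5 * expR (modulus z).
Proof.
apply/ler_addgt0Pr => e e0.
have eC : 0 < e%:C :> R[i] by rewrite ltcR.
have /cvgrPdist_lt /(_ _ eC) [N _ closeN] := @cvg_cexp z.
have {closeN} := closeN (N + 5)%N (leq_addr _ _).
rewrite modulusE ltcR /series /= => closeN.
set s := \sum_(0 <= k < N + 5) _ in closeN.
have -> : cexp z - exp_taylor4 z =
    (\sum_(5 <= k < N + 5) z ^+ k / k`!%:R) + (cexp z - s).
  rewrite exp_taylor4_series /s (@big_cat_nat _ _ _ 5%N 0%N (N + 5)%N) //=.
    by ring.
  exact: leq_addl.
by rewrite (le_trans (ler_modulusD _ _)) // lerD ?modulus_exp_tail // ltW.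
Qed.

(** [P] and [1 - P] are complementary idempotents, so the powers of the matrix
    act separately on their ranges. *)
Lemma exp_spectral n (P : 'M[R[i]]_n.+1) x y k :
  P * P = P -> (x *: P + y *: (1 - P)) ^+ k = x ^+ k *: P + y ^+ k *: (1 - P).
Proof.
move=> PP.
have PQ : P * (1 - P) = 0 by rewrite mulrBr mulr1 PP subrr.
have QP : (1 - P) * P = 0 by rewrite mulrBl mul1r PP subrr.
have QQ : (1 - P) * (1 - P) = 1 - P by rewrite mulrBr mulr1 QP subr0.
elim: k => [|k IHk]; first by rewrite !expr0 !scale1r addrC subrK.
rewrite exprS IHk mulrDl !mulrDr -!scalerAl -!scalerAr PP PQ QP QQ.
by rewrite !scaler0 addr0 add0r !scalerA -!exprS.
Qed.

(** Since the partial sums are combinations of the two fixed matrices [P] and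
    [1 - P], the matrix series converges as soon as two scalar ones do. *)
Lemma mexp_spectral n (P : 'M[R[i]]_n.+1) x y :
  P * P = P -> mexp (x *: P + y *: (1 - P)) * P = cexp x *: P.
Proof.
move=> PP.
have -> : mexp (x *: P + y *: (1 - P)) = cexp x *: P + cexp y *: (1 - P).
  apply: cvg_lim; first exact: norm_hausdorff.
  pose s w := series (fun k => w ^+ k / k`!%:R : R[i]).
  rewrite (_ : series _ = (fun k => s x k *: P + s y k *: (1 - P))).
    by apply: cvgD; apply: cvgZr_tmp; exact: cvg_cexp.
  apply/funext => k; rewrite /s /series /= !scaler_suml -big_split /=.
  apply: eq_bigr => j _.
  by rewrite exp_spectral // scalerDr !scalerA ![_^-1 * _]mulrC.
by rewrite mulrDl -!scalerAl PP mulrBl mul1r PP subrr scaler0 addr0.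
Qed.

End ComplexExponential.

(** * The branch of the square root stays in the right half-plane *)

Section SlowBranch.
Variables (R : realType) (a c K eps0 gamma : R) (zeta : R -> R[i] -> R[i]).
Hypothesis gamma0 : 0 < gamma.
Hypothesis zetaP : zeta_branch a c K eps0 zeta.
Hypothesis zeta_gamma : forall kappa eps : R,
  `|kappa| <= K -> 0 <= eps <= eps0 ->
  gamma%:C <= `|zeta eps ('i%C * kappa%:C)|.

(** If the real part vanishes at [eps], then [zeta ^+ 2] is a nonpositive real
    number there.  Its real part is [1 - (2 eps a kappa) ^+ 2], so [eps] and
    [kappa] are nonzero; its imaginary part is [- 4 eps c kappa], so [c] is 0.
    At each [x] of the interval [zeta ^+ 2] is now [1 - (2 x a kappa) ^+ 2], which
    vanishes for some [x <= eps], against the lower bound [gamma]. *)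
Lemma zeta_Re_neq0 kappa eps : `|kappa| <= K -> 0 <= eps <= eps0 ->
  Re (zeta eps ('i%C * kappa%:C)) != 0.
Proof.
move=> kK epsI; apply/eqP => re0.
have [_ _ zetaE] := zetaP kK.
have := zetaE _ epsI.
case: (zeta eps _) re0 => [x y] /= ->{x} /eqP.
rewrite !expr2 eq_complex /= => /andP[/eqP eRe /eqP eIm].
have {}eRe : - y ^+ 2 = 1 - (2 * eps * a * kappa) ^+ 2 by move: eRe; lra.
have {}eIm : eps * c * kappa = 0 by move: eIm; lra.
pose t := 2 * eps * a * kappa.
have t1 : 1 <= t ^+ 2 by rewrite /t -[leLHS]addr0; have := sqr_ge0 y; lra.
have t0 : t != 0.
  by apply: contraTneq t1 => ->; rewrite expr0n /= -ltNge ltr01.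
have c0 : c = 0.
  apply/eqP; apply: contraTT t0 => c0; rewrite negbK /t.
  have /eqP : (eps * kappa) * c = 0 by rewrite mulrAC.
  rewrite mulf_eq0 (negPf c0) orbF => /eqP ek.
  by rewrite -!mulrA [a * _]mulrC [eps * _]mulrA ek mul0r mulr0.
case/andP: epsI => eps_ge0 eps_le.
have nt1 : 1 <= `|t|.
  by rewrite -(@ler_pXn2r _ 2) ?nnegrE // expr1n real_normK ?num_real.
have nt0 : 0 < `|t| by apply: lt_le_trans nt1.
(* the point where [1 - (2 x a kappa) ^+ 2] is zero *)
pose x := eps / `|t|.
have x0 : 0 <= x by rewrite divr_ge0.
have xeps : x <= eps0.
  by apply: le_trans eps_le; rewrite ler_pdivrMr // ler_peMr.
have xI : 0 <= x <= eps0 by rewrite x0.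
have := zeta_gamma kK xI; rewrite modulusE lecR.
have /eqP : zeta x ('i%C * kappa%:C) ^+ 2 = 0.
  rewrite (zetaE _ xI) c0 rmorph0 mulr0 mul0r subr0.
  rewrite exprMn sqr_i mulrA -!rmorphXn /= mulrN1.
  have xt : 4 * x ^+ 2 * a ^+ 2 * kappa ^+ 2 = 1.
    have -> : 4 * x ^+ 2 * a ^+ 2 * kappa ^+ 2 = t ^+ 2 / `|t| ^+ 2.
      by rewrite /t /x; field; rewrite gt_eqF.
    by rewrite real_normK ?num_real // divff // expf_neq0.
  have := congr1 (real_complex R) xt.
  by rewrite !rmorphM /= rmorph_nat mulNr => ->; rewrite subrr.
rewrite expf_eq0 /= => /eqP ->.
by rewrite /modulus normr0 /= leNgt gamma0.
Qed.

Lemma zeta_Re_gt0 kappa eps : `|kappa| <= K -> 0 <= eps <= eps0 ->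
  0 < Re (zeta eps ('i%C * kappa%:C)).
Proof.
move=> kK /andP[eps_ge0 eps_le]; have [zc z0 _] := zetaP kK.
rewrite ltNge; apply/negP => zn.
pose f (x : R) := Re (zeta x ('i%C * kappa%:C)).
have fc : {within `[0, eps], continuous f}.
  have zc' : {within `[0, eps], continuous (fun x => zeta x ('i%C * kappa%:C))}.
    apply: continuous_subspaceW zc => x /=; rewrite !in_itv /=.
    by move=> /andP[-> /= /le_trans]; apply.
  move=> x; apply: continuous_comp; first exact: zc'.
  exact: continuous_Re.
have f0 : f 0 = 1 by rewrite /f z0.
have [|t] := IVT eps_ge0 fc (v := 0).
  by rewrite f0 ge_min le_max ler01 zn /= ?orbT.
rewrite in_itv /= => /andP[t0 te] /eqP; apply/negP.
by rewrite zeta_Re_neq0 // t0 (le_trans te).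
Qed.
End SlowBranch.

(** * The step on an eigenspace of L *)

Section StepOnEigenspace.
Variables (F : fieldType) (n : nat).
Hypothesis F0 : [pchar F] =i pred0.
Implicit Types (h l : F) (A B P : 'M[F]_n.+1).

Definition half_implicit h A B : 'M[F]_n.+1 :=
  1 - (h / 2) *: B + (h ^+ 2 / 8) *: (B * (A + B)).

Definition full_implicit h A B : 'M[F]_n.+1 :=
  1 - h *: B + (h ^+ 2 / 6) *: (B * (A + B)).

Let natS_neq0 k : k.+1%:R != 0 :> F.
Proof. by rewrite ((pcharf0P F).1 F0). Qed.

(** Multiply by the implicit matrix [E]: both [E P] and the explicit matrix
    applied to [P] are combinations of [P] and [B P], as [A P = l P - B P] and
    [(A + B) P = l P].  Subtracting the multiple of [E P] that cancels [P] leaves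
    a coefficient of [B P] in which all powers of [h] but the fourth cancel. *)
Lemma step_half_eigen h l A B P :
  (A + B) * P = l *: P -> half_implicit h A B \is a GRing.unit ->
  step_half h A B * P =
    (1 + h * l / 2 + (h * l) ^+ 2 / 8) *: P
    - (h ^+ 4 * l ^+ 3 / 64) *: ((half_implicit h A B)^-1 * (B * P)).
Proof.
move=> LP uE; pose N := 1 + (h / 2) *: A + (h ^+ 2 / 8) *: (A * (A + B)).
rewrite (_ : step_half h A B = (half_implicit h A B)^-1 * N) // -[LHS]mulrA.
suff NP : N * P =
    (1 + h * l / 2 + (h * l) ^+ 2 / 8) *: (half_implicit h A B * P)
    - (h ^+ 4 * l ^+ 3 / 64) *: (B * P).
  by rewrite NP mulrBr -!scalerAr (mulKr uE).
have AP : A * P = l *: P - B * P by rewrite -LP mulrDl addrK.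
rewrite /half_implicit /N !mulrDl mulNr -!scalerAl !mul1r -!mulrA LP.
rewrite -!scalerAr AP.
move: (B * P) => X; apply/matrixP => i j; rewrite !mxE.
by field; rewrite !natS_neq0.
Qed.

(** The mechanism is that of [step_half_eigen].  The half stage enters through
    [h ^+ 2 / 3 * (A - B) L], so its defect of order [h ^+ 4] only appears with
    the factor [h ^+ 6]. *)
Lemma step_eigen h l A B P :
  (A + B) * P = l *: P -> half_implicit h A B \is a GRing.unit ->
  full_implicit h A B \is a GRing.unit ->
  step h A B * P =
    exp_taylor4 (h * l) *: P
    + (h ^+ 5 * l ^+ 4 * (1 / 72 - h * l / 144))
      *: ((full_implicit h A B)^-1 * (B * P))
    - (h ^+ 6 * l ^+ 3 / 192) *: ((full_implicit h A B)^-1 *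
        ((A - B) * (A + B) * ((half_implicit h A B)^-1 * (B * P)))).
Proof.
move=> LP uE uD; pose M := 1 + h *: A + (h ^+ 2 / 6) *: (A * (A + B)) +
          (h ^+ 2 / 3) *: ((A - B) * (A + B) * step_half h A B).
rewrite (_ : step h A B = (full_implicit h A B)^-1 * M) // -[LHS]mulrA.
set Y := (half_implicit h A B)^-1 * (B * P).
suff MP : M * P =
    exp_taylor4 (h * l) *: (full_implicit h A B * P)
    + (h ^+ 5 * l ^+ 4 * (1 / 72 - h * l / 144)) *: (B * P)
    - (h ^+ 6 * l ^+ 3 / 192) *: ((A - B) * (A + B) * Y).
  by rewrite MP mulrBr mulrDr -!scalerAr (mulKr uD).
have AP : A * P = l *: P - B * P by rewrite -LP mulrDl addrK.
have SP := step_half_eigen LP uE; rewrite -/Y in SP.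
set c1 := (1 + h * l / 2 + (h * l) ^+ 2 / 8) in SP.
have ABSP : (A - B) * (A + B) * step_half h A B * P =
    (c1 * l) *: (l *: P - 2 *: (B * P))
    - (h ^+ 4 * l ^+ 3 / 64) *: ((A - B) * (A + B) * Y).
  rewrite -mulrA SP mulrBr -!scalerAr -[in X in X - _]mulrA LP -scalerAr scalerA.
  by rewrite mulrBl AP -addrA -opprD -mulr2n scaler_nat.
rewrite /full_implicit /M /exp_taylor4.
move: ABSP; set Z := (A - B) * (A + B) * Y.
set W := (A - B) * (A + B) * step_half h A B => WP.
rewrite !mulrDl mulNr -!scalerAl WP !mul1r -!mulrA LP -!scalerAr AP.
move: (B * P) Z {WP} => X Z.
by apply/matrixP => i j; rewrite !mxE /c1; field; rewrite !natS_neq0.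
Qed.

End StepOnEigenspace.

(** * Matrices of size two by entries *)

Section TwoByTwo.
Variable F : fieldType.
Implicit Types x y p q r s : F.

Lemma mx2P (M N : 'M[F]_2) :
  M 0 0 = N 0 0 -> M 0 1 = N 0 1 -> M 1 0 = N 1 0 -> M 1 1 = N 1 1 -> M = N.
Proof.
move=> e00 e01 e10 e11; apply/matrixP => i j.
have ord2 (k : 'I_2) : k = 0 \/ k = 1.
  by case: k => [[|[|//]] lt_k]; [left|right]; apply/val_inj.
by case: (ord2 i) => ->; case: (ord2 j) => ->.
Qed.

Lemma mul_mx2 x00 x01 x10 x11 y00 y01 y10 y11 :
  mx2 x00 x01 x10 x11 * mx2 y00 y01 y10 y11 =
  mx2 (x00 * y00 + x01 * y10) (x00 * y01 + x01 * y11)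
      (x10 * y00 + x11 * y10) (x10 * y01 + x11 * y11).
Proof. by apply/mx2P; rewrite !mxE !big_ord_recl big_ord0 !mxE /= addr0. Qed.

Lemma add_mx2 x00 x01 x10 x11 y00 y01 y10 y11 :
  mx2 x00 x01 x10 x11 + mx2 y00 y01 y10 y11 =
  mx2 (x00 + y00) (x01 + y01) (x10 + y10) (x11 + y11).
Proof. by apply/mx2P; rewrite !mxE. Qed.

Lemma opp_mx2 x00 x01 x10 x11 :
  - mx2 x00 x01 x10 x11 = mx2 (- x00) (- x01) (- x10) (- x11).
Proof. by apply/mx2P; rewrite !mxE. Qed.

Lemma scale_mx2 k x00 x01 x10 x11 :
  k *: mx2 x00 x01 x10 x11 = mx2 (k * x00) (k * x01) (k * x10) (k * x11).
Proof. by apply/mx2P; rewrite !mxE. Qed.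

Lemma one_mx2 : (1 : 'M[F]_2) = mx2 1 0 0 1.
Proof. by apply/mx2P; rewrite !mxE. Qed.

Definition mx2E := (one_mx2, mul_mx2, opp_mx2, scale_mx2, add_mx2).

Lemma lower_mx2V y t : t != 0 ->
  mx2 1 0 y t \is a GRing.unit /\ (mx2 1 0 y t)^-1 = mx2 1 0 (- (y / t)) t^-1.
Proof.
move=> t0; set M := mx2 1 0 y t; set N := mx2 _ _ _ t^-1.
have MN : M * N = 1 by rewrite /M /N !mx2E; congr mx2; field.
have NM : N * M = 1 by rewrite /M /N !mx2E; congr mx2; field.
have uM : M \is a GRing.unit by apply/unitrP; exists N.
by split=> //; apply: (mulrI uM); rewrite MN mulrV.
Qed.

End TwoByTwo.

(** * The slow spectral data of the Jin-Xin block *)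

Section JinXinBlock.
Variables (R : realType) (a c eps : R) (d z : R[i]).
Hypothesis eps0 : eps != 0.
Hypothesis z0 : z != 0.
Hypothesis z1 : 1 + z != 0.
Hypothesis disc : z ^+ 2 = 1 - 4 * eps%:C * c%:C * d
                            + 4 * eps%:C ^+ 2 * a%:C ^+ 2 * d ^+ 2.

Local Notation e := (eps%:C).
Local Notation l := (lambda_s a c eps d z).
Local Notation A := (jxA a d).
Local Notation B := (jxB c eps).

Let e0 : e != 0. Proof. by rewrite fmorph_eq0. Qed.

Lemma pchar_complex : [pchar R[i]] =i pred0.
Proof. exact: pchar_num. Qed.

Lemma eps_lambda_s : e * l = (z - 1) / 2.
Proof.
apply: (mulIf z1); rewrite /lambda_s.
have -> : e * (2 * (e * a%:C ^+ 2 * d ^+ 2 - c%:C * d) / (1 + z)) * (1 + z)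
   = (4 * e ^+ 2 * a%:C ^+ 2 * d ^+ 2 - 4 * e * c%:C * d) / 2 by field.
have -> : 4 * e ^+ 2 * a%:C ^+ 2 * d ^+ 2 - 4 * e * c%:C * d = z ^+ 2 - 1.
  by rewrite disc; ring.
by field.
Qed.

(** [Pi_s] is the product of the column vector [(1, slope)] and the row vector
    [(coord1, coord2)], a right and a left eigenvector of [L].  This factorization
    divides the first column of [Pi_s] by its top entry [pivot / z], and the pivot
    is nonzero because it equals [(1 + z) / 2]. *)
Definition pivot : R[i] := 1 + e * l.
Definition slope : R[i] := (c%:C - e * a%:C ^+ 2 * d) / pivot.
Definition coord1 : R[i] := pivot / z.
Definition coord2 : R[i] := - (e * d) / z.

Lemma pivotE : pivot = (1 + z) / 2.
Proof. by rewrite /pivot eps_lambda_s; field. Qed.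

Lemma pivot_neq0 : pivot != 0.
Proof. by rewrite pivotE mulf_neq0 // invr_eq0 pnatr_eq0. Qed.

(** This is the characteristic equation
    [e l ^+ 2 + l + c d - e a ^+ 2 d ^+ 2 = 0] of the slow eigenvalue. *)
Lemma slow_eigenvalue_eq : l * pivot = - d * (c%:C - e * a%:C ^+ 2 * d).
Proof.
apply: (mulfI e0); rewrite mulrA eps_lambda_s pivotE.
have -> : (z - 1) / 2 * ((1 + z) / 2) = (z ^+ 2 - 1) / 4 by field.
by rewrite disc; field.
Qed.

Lemma slopeK : slope * pivot = c%:C - e * a%:C ^+ 2 * d.
Proof. by rewrite /slope divfK ?pivot_neq0. Qed.

Lemma slope_first_row : l = - d * slope.
Proof.
by apply: (mulIf pivot_neq0); rewrite slow_eigenvalue_eq -[RHS]mulrA slopeK.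
Qed.

Lemma coord_dual : coord1 + coord2 * slope = 1.
Proof.
have -> : coord2 * slope = e * l / z by rewrite slope_first_row /coord2; field.
rewrite /coord1 -mulrDl pivotE eps_lambda_s; field; exact: z0.
Qed.

Lemma Pi_s_rank1 :
  Pi_s a c eps d z =
  mx2 coord1 coord2 (slope * coord1) (slope * coord2).
Proof.
rewrite /Pi_s scale_mx2; congr mx2.
- by rewrite /coord1 mulrC.
- by rewrite /coord2 mulrC.
- by rewrite /coord1 mulrA slopeK mulrC.
- by rewrite [in LHS]slope_first_row /coord2; field.
Qed.

Lemma jxLE : A + B = mx2 0 (- d) (c%:C / e - a%:C ^+ 2 * d) (- e^-1).
Proof. by rewrite /jxA /jxB !mx2E; congr mx2; ring. Qed.

Lemma Pi_s_idem : Pi_s a c eps d z * Pi_s a c eps d z = Pi_s a c eps d z.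
Proof.
suff -> : Pi_s a c eps d z * Pi_s a c eps d z =
          (coord1 + coord2 * slope) *: Pi_s a c eps d z.
  by rewrite coord_dual scale1r.
by rewrite Pi_s_rank1 !mx2E; congr mx2; ring.
Qed.

(** The trace of [L] is [- e ^-1], which determines the eigenvalue on the range of
    [1 - Pi_s]. *)
Lemma jxL_spectral :
  jxL a c eps d = l *: Pi_s a c eps d z
    + (- e^-1 - l) *: (1 - Pi_s a c eps d z).
Proof.
have lE : l = (z - 1) / 2 / e by rewrite -eps_lambda_s mulrC mulKf.
have c1E : coord1 = (1 + z) / 2 / z by rewrite /coord1 pivotE.
have gc2 : slope * coord2 = (z - 1) / 2 / z.
  rewrite mulrC; apply: (addrI coord1); rewrite coord_dual c1E.
  by field.
have gc1 : slope * coord1 = (c%:C - e * a%:C ^+ 2 * d) / z.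
  by rewrite /coord1 mulrA slopeK.
rewrite /jxL jxLE Pi_s_rank1 gc1 gc2 lE c1E /coord2 !mx2E.
by congr mx2; field; rewrite ?e0 ?z0.
Qed.

Lemma jxL_Pi_s : (A + B) * Pi_s a c eps d z = l *: Pi_s a c eps d z.
Proof.
have PP := Pi_s_idem; have := jxL_spectral; rewrite /jxL => ->.
move: (Pi_s a c eps d z) PP => P PP.
by rewrite mulrDl -!scalerAl mulrBl mul1r PP subrr scaler0 addr0.
Qed.

(** The second component of [B (1, slope)], written as that of
    [l (1, slope) - A (1, slope)]: in this form no inverse power of [eps] is
    left. *)
Definition stiff : R[i] := l * slope + a%:C ^+ 2 * d.

Lemma jxB_Pi_s :
  B * Pi_s a c eps d z = mx2 0 0 (stiff * coord1) (stiff * coord2).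
Proof.
have -> : B * Pi_s a c eps d z =
    l *: Pi_s a c eps d z - A * Pi_s a c eps d z.
  by rewrite -jxL_Pi_s mulrDl addrC addKr.
rewrite /jxA Pi_s_rank1 !mx2E /stiff; congr mx2; try ring.
- by rewrite [in LHS]slope_first_row; ring.
- by rewrite [in LHS]slope_first_row; ring.
Qed.

Lemma Pi_s_neq0 : Pi_s a c eps d z != 0.
Proof.
apply/eqP; rewrite Pi_s_rank1 => /matrixP P0.
have := P0 0 0; have := P0 1 1; rewrite !mxE /= => P11 P00.
have := coord_dual; rewrite [coord2 * _]mulrC P11 P00 addr0 => /eqP.
by rewrite eq_sym oner_eq0.
Qed.

(** The lower entries of the matrix [1 - s B + t B L]; for suitable [s] and [t]
    it is the matrix inverted in either stage of the step. *)
Definition imp21 s t : R[i] :=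
  - (s * c%:C / e) - t * (c%:C / e - a%:C ^+ 2 * d) / e.
Definition imp22 s t : R[i] := 1 + s / e + t * (e^-1 - c%:C * d) / e.

Lemma implicitE s t :
  1 - s *: B + t *: (B * (A + B)) = mx2 1 0 (imp21 s t) (imp22 s t).
Proof.
rewrite jxLE /jxB !mx2E /imp21 /imp22; congr mx2; try ring; by field.
Qed.

(** The projected amplification factor.  Here [te] and [td] are the lower pivots
    of the two inverted matrices, [y] is the subdiagonal entry of the one of the
    final stage, and [(p, r)] is the second column of [(A - B) L]. *)
Definition jx_q (h : R[i]) : R[i] :=
  let te := imp22 (h / 2) (h ^+ 2 / 8) in
  let td := imp22 h (h ^+ 2 / 6) in
  let y := imp21 h (h ^+ 2 / 6) in
  let p := d / e in
  let r := a%:C ^+ 2 * d ^+ 2 + c%:C * d / e - (e ^+ 2)^-1 in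
  exp_taylor4 (h * l)
  + h ^+ 5 * l ^+ 4 * (1 / 72 - h * l / 144) * (coord2 * (stiff / td))
  - h ^+ 6 * l ^+ 3 / 192 *
      (stiff / te * (coord1 * p + coord2 * ((r - y * p) / td))).

(** [B Pi_s] has a zero first row, so the inverse of the lower triangular matrix
    of the half stage acts on it as a division by the pivot; multiplying by the
    rank one matrix [Pi_s] on the left turns each term into a multiple of
    [Pi_s]. *)
Lemma Pi_s_step h :
  imp22 (h / 2) (h ^+ 2 / 8) != 0 -> imp22 h (h ^+ 2 / 6) != 0 ->
  Pi_s a c eps d z * step h A B * Pi_s a c eps d z
  = jx_q h *: Pi_s a c eps d z.
Proof.
move=> te0 td0.
have [uE VE] := lower_mx2V (imp21 (h / 2) (h ^+ 2 / 8)) te0.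
have [uD VD] := lower_mx2V (imp21 h (h ^+ 2 / 6)) td0.
have hE : half_implicit h A B = _ := implicitE _ _.
have hD : full_implicit h A B = _ := implicitE _ _.
have SP := step_eigen pchar_complex jxL_Pi_s (h := h).
rewrite hE hD VE VD jxB_Pi_s in SP; move/(_ uE uD) in SP.
have PP := Pi_s_idem; have PE := Pi_s_rank1.
rewrite -mulrA SP; move: (Pi_s a c eps d z) PP PE {SP} => P PP PE.
rewrite mulrBr mulrDr -!scalerAr PP /jx_q [RHS]scalerBl [X in _ = X - _]scalerDl.
congr (_ + _ - _); rewrite -[RHS]scalerA; congr (_ *: _).
- by rewrite PE !mx2E; congr mx2; ring.
- by rewrite jxLE /jxA /jxB PE !mx2E; congr mx2; field; rewrite ?e0 ?te0 ?td0.
Qed.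

End JinXinBlock.

(** * Bounds uniform in eps and h *)

Section Bounds.
Variables (R : realType) (a c K eps0 h0 gamma : R).

Definition lambda_max : R := 2 * (eps0 * `|a| ^+ 2 * K ^+ 2 + `|c| * K).
Definition slope_max : R := 2 * (`|c| + eps0 * `|a| ^+ 2 * K).
Definition stiff_max : R := lambda_max * slope_max + `|a| ^+ 2 * K.
Definition coord1_max : R := (1 + eps0 * lambda_max) / gamma.
(** Bounds [eps ^+ 2] times the second component of [D^-1 (p, r)], [D] being the
    matrix inverted in the final stage and [(p, r)] the second column of
    [(A - B) L].  When [h] is of the size of [eps], the component itself is of
    size [eps ^- 2]. *)
Definition residual_max : R :=
  eps0 ^+ 2 * `|a| ^+ 2 * K ^+ 2 + eps0 * `|c| * K + 1
  + eps0 * (2 * `|c| + eps0 * `|a| ^+ 2 * K) * K.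
Definition defect_max : R :=
  lambda_max ^+ 4 * (1 / 72 + h0 * lambda_max / 144)
    * (eps0 * (K / gamma) * stiff_max)
  + lambda_max ^+ 3 / 192
    * (2 * stiff_max * (coord1_max * K + K / gamma * residual_max)).

Variables (kappa eps h : R) (z : R[i]).
Hypothesis gamma_gt0 : 0 < gamma.
Hypothesis kappaK : `|kappa| <= K.
Hypothesis eps_gt0 : 0 < eps.
Hypothesis eps_le : eps <= eps0.
Hypothesis h_gt0 : 0 < h.
Hypothesis h_le : h <= h0.
Hypothesis z_ge : gamma <= modulus z.
Hypothesis z_Re : 0 <= Re z.
Local Notation d := ('i%C * kappa%:C).
Hypothesis disc : z ^+ 2 = 1 - 4 * eps%:C * c%:C * d
                            + 4 * eps%:C ^+ 2 * a%:C ^+ 2 * d ^+ 2.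
Local Notation l := (lambda_s a c eps d z).
Local Notation e := (eps%:C).

Let K_ge0 : 0 <= K. Proof. exact: le_trans kappaK. Qed.
Let eps0_gt0 : 0 < eps0. Proof. exact: lt_le_trans eps_le. Qed.
Let h0_gt0 : 0 < h0. Proof. exact: lt_le_trans h_le. Qed.
Let eps_neq0 : eps != 0. Proof. exact: lt0r_neq0. Qed.

Let modulus_d : modulus d = `|kappa|.
Proof. by rewrite modulusM modulus_i modulus_real mul1r. Qed.

Let modulus_e : modulus e = eps.
Proof. by rewrite modulus_real gtr0_norm. Qed.

Let modulus_1z : 1 <= modulus (1 + z).
Proof.
apply: le_trans (ler_Re_modulus _); rewrite ReD /= ger0_norm ?lerDl //.
by rewrite addr_ge0.
Qed.

Lemma disc_1z_neq0 : 1 + z != 0.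
Proof.
apply: contraTneq modulus_1z => ->.
by rewrite /modulus normr0 /= -ltNge ltr01.
Qed.

Lemma gap_neq0 : z != 0.
Proof.
apply: contraTneq z_ge => ->.
by rewrite /modulus normr0 /= -ltNge.
Qed.

Let e_neq0 : e != 0. Proof. by rewrite fmorph_eq0. Qed.

Lemma lambda_max_ge0 : 0 <= lambda_max.
Proof.
by rewrite /lambda_max mulr_ge0 // addr_ge0 ?mulr_ge0 ?exprn_ge0 // ltW.
Qed.

Lemma modulus_lambda_s : modulus l <= lambda_max.
Proof.
rewrite /lambda_s 2!modulusM modulus_nat modulusV /lambda_max -mulrA.
rewrite ler_wpM2l // ler_pdivrMr ?(lt_le_trans ltr01) //.
apply: (@le_trans _ _ (eps0 * `|a| ^+ 2 * K ^+ 2 + `|c| * K)); last first.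
  by rewrite ler_peMr // addr_ge0 ?mulr_ge0 ?exprn_ge0 ?(ltW eps0_gt0).
apply: le_trans (ler_modulusB _ _) _.
rewrite !(modulusX, modulusM, modulus_real, modulus_i) !mul1r (gtr0_norm eps_gt0).
rewrite lerD //; last by rewrite ler_wpM2l.
apply: ler_pM; rewrite ?mulr_ge0 ?exprn_ge0 ?(ltW eps_gt0) //.
  by rewrite ler_wpM2r ?exprn_ge0.
by rewrite lerXn2r ?nnegrE.
Qed.

Lemma modulus_pivot_ge : 1 / 2 <= modulus (pivot a c eps d z).
Proof.
rewrite (pivotE disc_1z_neq0 disc) modulusM modulusV modulus_nat.
by rewrite ler_pM2r ?invr_gt0.
Qed.

Lemma modulus_slope : modulus (slope a c eps d z) <= slope_max.
Proof.
have p0 : 0 < modulus (pivot a c eps d z).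
  by apply: lt_le_trans modulus_pivot_ge; rewrite divr_gt0.
rewrite /slope modulusM modulusV ler_pdivrMr //.
have num_le : modulus (c%:C - e * a%:C ^+ 2 * d) <= `|c| + eps0 * `|a| ^+ 2 * K.
  apply: le_trans (ler_modulusB _ _) _.
  rewrite !(modulusX, modulusM, modulus_real, modulus_i) !mul1r (gtr0_norm eps_gt0).
  rewrite lerD2l.
  apply: ler_pM; rewrite ?mulr_ge0 ?exprn_ge0 ?(ltW eps_gt0) //.
  by rewrite ler_wpM2r ?exprn_ge0.
apply: (le_trans num_le).
rewrite /slope_max [leRHS]mulrAC [leRHS]mulrC ler_peMr //.
  exact: le_trans (modulus_ge0 _) num_le.
by have := modulus_pivot_ge; lra.
Qed.

Lemma modulus_stiff : modulus (stiff a c eps d z) <= stiff_max.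
Proof.
rewrite /stiff; apply: le_trans (ler_modulusD _ _) _.
rewrite lerD //.
  rewrite modulusM; apply: ler_pM; rewrite ?modulus_ge0 //.
    exact: modulus_lambda_s.
  exact: modulus_slope.
rewrite !(modulusX, modulusM, modulus_real, modulus_i) !mul1r.
by rewrite ler_wpM2l ?exprn_ge0.
Qed.

Let modulus_zV : (modulus z)^-1 <= gamma^-1.
Proof. by rewrite lef_pV2 ?posrE // (lt_le_trans gamma_gt0). Qed.

Lemma modulus_coord1 : modulus (coord1 a c eps d z) <= coord1_max.
Proof.
rewrite /coord1 modulusM modulusV.
apply: ler_pM; rewrite ?invr_ge0 ?modulus_ge0 //.
rewrite /pivot; apply: le_trans (ler_modulusD _ _) _.
rewrite (_ : modulus 1 = 1); last by rewrite (modulus_nat _ 1).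
rewrite lerD2l modulusM modulus_e.
by apply: ler_pM; rewrite ?modulus_ge0 ?modulus_lambda_s // ltW.
Qed.

Lemma modulus_coord2 : modulus (coord2 eps d z) <= eps * (K / gamma).
Proof.
rewrite /coord2 modulusM modulusV modulusN [modulus (e * d)]modulusM.
rewrite modulus_e modulus_d -mulrA ler_wpM2l ?(ltW eps_gt0) //.
by apply: ler_pM; rewrite ?invr_ge0 ?modulus_ge0.
Qed.

(** As [d] is purely imaginary, the left-hand side is the real part of the
    pivot. *)
Lemma modulus_imp22 (s t : R) :
  1 + s / eps + t / eps ^+ 2 <= modulus (imp22 c eps d s%:C t%:C).
Proof.
apply: le_trans (le_trans (ler_norm _) (ler_Re_modulus _)).
have -> : imp22 c eps d s%:C t%:C =
    (1 + s / eps + t / eps ^+ 2)%:C + 'i%C * (- (t * c * kappa / eps))%:C.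
  rewrite /imp22 !(rmorphD, rmorphN, rmorphM, rmorphXn, fmorphV) /= rmorph1.
  by field.
by rewrite ReD /= !mul0r mul1r subr0 addr0.
Qed.

Let hh : h%:C / 2 = (h / 2)%:C.
Proof. by rewrite fmorph_div rmorph_nat. Qed.

Let hh2 (k : nat) : h%:C ^+ 2 / k%:R = (h ^+ 2 / k%:R)%:C.
Proof. by rewrite fmorph_div rmorphXn rmorph_nat. Qed.

Lemma half_pivot_ge :
  h / (2 * eps) <= modulus (imp22 c eps d (h%:C / 2) (h%:C ^+ 2 / 8)).
Proof.
rewrite hh hh2; apply: le_trans (modulus_imp22 _ _).
have -> : h / (2 * eps) = h / 2 / eps by field.
rewrite -[leLHS]addr0 lerD ?lerDr //.
by rewrite !(divr_ge0, exprn_ge0) // ltW.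
Qed.

Lemma full_pivot_ge :
  [/\ 1 <= modulus (imp22 c eps d h%:C (h%:C ^+ 2 / 6)),
      h / eps <= modulus (imp22 c eps d h%:C (h%:C ^+ 2 / 6)) &
      h ^+ 2 / 6 / eps ^+ 2
        <= modulus (imp22 c eps d h%:C (h%:C ^+ 2 / 6))].
Proof.
have ge0 : 0 <= h / eps by rewrite divr_ge0 ?ltW.
have ge02 : 0 <= h ^+ 2 / 6 / eps ^+ 2 by rewrite !(divr_ge0, exprn_ge0) // ltW.
rewrite hh2; have := modulus_imp22 h (h ^+ 2 / 6).
by split; lra.
Qed.

Let half_pivot_gt0 :
  0 < modulus (imp22 c eps d (h%:C / 2) (h%:C ^+ 2 / 8)).
Proof. by apply: lt_le_trans half_pivot_ge; rewrite divr_gt0 ?mulr_gt0. Qed.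

Let full_pivot_gt0 :
  0 < modulus (imp22 c eps d h%:C (h%:C ^+ 2 / 6)).
Proof. by apply: lt_le_trans ltr01 _; case: full_pivot_ge. Qed.

Lemma modulus_gt0_neq0 (w : R[i]) : 0 < modulus w -> w != 0.
Proof. by apply: contraTneq => ->; rewrite /modulus normr0 /= ltxx. Qed.

(* the quantities named in the same way in [jx_q] *)
Let p : R[i] := d / e.
Let r : R[i] := a%:C ^+ 2 * d ^+ 2 + c%:C * d / e - (e ^+ 2)^-1.
Let y : R[i] := imp21 a c eps d h%:C (h%:C ^+ 2 / 6).
Let td : R[i] := imp22 c eps d h%:C (h%:C ^+ 2 / 6).

Lemma modulus_r :
  eps ^+ 2 * modulus r
    <= eps0 ^+ 2 * `|a| ^+ 2 * K ^+ 2 + eps0 * `|c| * K + 1.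
Proof.
have -> : eps ^+ 2 * modulus r =
    modulus (e ^+ 2 * a%:C ^+ 2 * d ^+ 2 + e * c%:C * d - 1).
  rewrite -[in LHS]modulus_e -modulusX -modulusM /r; congr modulus.
  by field.
apply: le_trans (ler_modulusB _ _) _.
rewrite (_ : modulus 1 = 1); last by rewrite (modulus_nat _ 1).
rewrite lerD2r; apply: le_trans (ler_modulusD _ _) _.
rewrite !(modulusX, modulusM, modulus_real, modulus_i) !mul1r (gtr0_norm eps_gt0).
rewrite lerD //.
  apply: ler_pM; rewrite ?mulr_ge0 ?exprn_ge0 ?(ltW eps_gt0) //.
    rewrite ler_wpM2r ?exprn_ge0 // lerXn2r ?nnegrE ?(ltW eps_gt0) //.
    exact: ltW.
  by rewrite lerXn2r ?nnegrE.
apply: ler_pM; rewrite ?mulr_ge0 ?(ltW eps_gt0) //.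
by rewrite ler_wpM2r.
Qed.

(** The two terms of [eps * y] are of size [h] and [h ^+ 2 / eps]; the pivot
    dominates them because it is at least [h / eps] and
    [h ^+ 2 / (6 eps ^+ 2)]. *)
Lemma modulus_y :
  eps * modulus y
    <= eps0 * (2 * `|c| + eps0 * `|a| ^+ 2 * K) * modulus td.
Proof.
have [_ t1 t2] := full_pivot_ge; rewrite -/td in t1 t2.
have -> : eps * modulus y =
    modulus (h%:C * c%:C + h%:C ^+ 2 / 6 * (c%:C / e - a%:C ^+ 2 * d)).
  rewrite -[in LHS]modulus_e -modulusM -modulusN /y /imp21; congr modulus.
  by field.
apply: le_trans (ler_modulusD _ _) _.
have ht : h <= eps * modulus td by rewrite mulrC -ler_pdivrMr.
have h2t : h ^+ 2 / 6 <= eps ^+ 2 * modulus td.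
  by rewrite [leRHS]mulrC -ler_pdivrMr ?exprn_gt0.
have ak : modulus (c%:C / e - a%:C ^+ 2 * d) <= `|c| / eps + `|a| ^+ 2 * K.
  apply: le_trans (ler_modulusB _ _) _.
  rewrite !(modulusX, modulusM, modulusV, modulus_real, modulus_i) mul1r.
  by rewrite (gtr0_norm eps_gt0) lerD2l ler_wpM2l ?exprn_ge0.
apply: (@le_trans _ _ (eps * modulus td * `|c| +
    eps ^+ 2 * modulus td * (`|c| / eps + `|a| ^+ 2 * K))).
  rewrite lerD //.
    by rewrite modulusM !modulus_real (gtr0_norm h_gt0) ler_wpM2r.
  rewrite modulusM hh2 modulus_real ger0_norm; last first.
    by rewrite divr_ge0 ?exprn_ge0 // ltW.
  apply: ler_pM => //; first by rewrite divr_ge0 ?exprn_ge0 // ltW.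
  exact: modulus_ge0.
have -> : eps * modulus td * `|c| +
    eps ^+ 2 * modulus td * (`|c| / eps + `|a| ^+ 2 * K) =
    eps * (2 * `|c| + eps * `|a| ^+ 2 * K) * modulus td by field.
rewrite ler_wpM2r ?modulus_ge0 //.
apply: ler_pM => //; first exact: ltW.
  by rewrite !(addr_ge0, mulr_ge0, exprn_ge0) // ltW.
by rewrite lerD2l !ler_wpM2r ?exprn_ge0.
Qed.

Lemma modulus_residual :
  eps ^+ 2 * modulus ((r - y * p) / td) <= residual_max.
Proof.
have [t1 _ _] := full_pivot_ge; rewrite -/td in t1.
have t0 : 0 < modulus td := full_pivot_gt0.
rewrite modulusM modulusV mulrA ler_pdivrMr //.
have := ler_modulusB r (y * p) => /(ler_wpM2l (exprn_ge0 2 (ltW eps_gt0))).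
move=> /le_trans; apply; rewrite mulrDr.
have -> : eps ^+ 2 * modulus (y * p) = eps * modulus y * `|kappa|.
  rewrite modulusM /p [modulus (d / e)]modulusM modulus_d modulusV modulus_e.
  by field.
rewrite /residual_max mulrDl lerD //.
  apply: (le_trans modulus_r); rewrite ler_peMr //.
  by rewrite !(addr_ge0, mulr_ge0, exprn_ge0) ?(ltW eps0_gt0).
rewrite [leRHS]mulrAC; apply: ler_pM => //; last exact: modulus_y.
by rewrite mulr_ge0 ?modulus_ge0 ?ltW.
Qed.

Let X : R[i] := coord1 a c eps d z * p + coord2 eps d z * ((r - y * p) / td).

(** The row vector of [Pi_s] compensates the growth of the second component: its
    second entry carries a factor [eps]. *)
Lemma modulus_X :
  eps * modulus X <= coord1_max * K + K / gamma * residual_max.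
Proof.
have eps_ge0 := ltW eps_gt0.
have := ler_wpM2l eps_ge0 (ler_modulusD (coord1 a c eps d z * p)
  (coord2 eps d z * ((r - y * p) / td))).
move=> /le_trans; apply; rewrite mulrDr lerD //.
  have -> : eps * modulus (coord1 a c eps d z * p) =
      modulus (coord1 a c eps d z) * `|kappa|.
    rewrite modulusM [modulus p]modulusM modulusV modulus_e modulus_d.
    by field.
  by apply: ler_pM; rewrite ?modulus_ge0 ?modulus_coord1.
rewrite modulusM; set s := modulus (_ / td).
have c2 := modulus_coord2; have s0 : 0 <= s := modulus_ge0 _.
apply: (@le_trans _ _ (K / gamma * (eps ^+ 2 * s))); last first.
  by rewrite ler_wpM2l ?divr_ge0 ?modulus_residual // ltW.
rewrite (_ : K / gamma * (eps ^+ 2 * s) = eps * (eps * (K / gamma) * s)).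
  by rewrite ler_wpM2l // ler_wpM2r.
by ring.
Qed.

(** In the last term of [jx_q] one factor [h] is spent on the pivot [te], which is
    at least [h / (2 eps)]; the factor [2 eps] gained is the one needed in
    [modulus_X]. *)
Lemma jx_q_taylor :
  modulus (jx_q a c eps d z h%:C - exp_taylor4 (h%:C * l))
    <= defect_max * h ^+ 5.
Proof.
have t1 : 1 <= modulus td by case: full_pivot_ge.
have t0 : 0 < modulus td := full_pivot_gt0.
have modulusM4 (x1 x2 x3 x4 : R[i]) : modulus (x1 * x2 * x3 * x4) =
    modulus x1 * modulus x2 * modulus x3 * modulus x4 by rewrite !modulusM.
have modulus_h k : modulus (h%:C ^+ k) = h ^+ k.
  by rewrite modulusX modulus_real gtr0_norm.
have l_pow k : modulus (l ^+ k) <= lambda_max ^+ k.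
  rewrite modulusX lerXn2r ?nnegrE ?modulus_ge0 ?lambda_max_ge0 //.
  exact: modulus_lambda_s.
rewrite /jx_q /= -/td -/y -/p -/r -/X.
set te := imp22 _ _ _ (h%:C / 2) _.
have te0 : 0 < modulus te := half_pivot_gt0.
have cancelT (T U V : R[i]) : T + U - V - T = U - V by ring.
rewrite cancelT; apply: le_trans (ler_modulusB _ _) _.
rewrite /defect_max [leRHS]mulrDl lerD //.
  have -> : modulus (h%:C ^+ 5 * l ^+ 4 * (1 / 72 - h%:C * l / 144) *
        (coord2 eps d z * (stiff a c eps d z / td))) =
      modulus (l ^+ 4) * modulus (1 / 72 - h%:C * l / 144) *
        (modulus (coord2 eps d z) * (modulus (stiff a c eps d z) / modulus td))
      * h ^+ 5.
    rewrite modulusM4 modulus_h [modulus (_ * (_ / td))]modulusM.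
    by rewrite [modulus (_ / td)]modulusM modulusV; ring.
  rewrite ler_wpM2r ?exprn_ge0 ?(ltW h_gt0) //.
  apply: ler_pM.
  - by rewrite mulr_ge0 ?modulus_ge0.
  - by rewrite !mulr_ge0 ?invr_ge0 ?modulus_ge0.
  - apply: ler_pM; rewrite ?modulus_ge0 //.
    apply: le_trans (ler_modulusB _ _) _.
    have -> : modulus (1 / 72 : R[i]) = 1 / 72.
      by rewrite !mul1r modulusV modulus_nat.
    rewrite lerD2l [modulus (_ / _)]modulusM [modulus (h%:C * _)]modulusM.
    rewrite modulusV modulus_nat modulus_real (gtr0_norm h_gt0).
    rewrite ler_wpM2r //; apply: ler_pM; rewrite ?modulus_ge0 ?modulus_lambda_s //.
    exact: ltW.
  apply: ler_pM.
  - exact: modulus_ge0.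
  - by rewrite mulr_ge0 ?invr_ge0 ?modulus_ge0.
  - apply: (le_trans modulus_coord2).
    by rewrite ler_wpM2r // divr_ge0 // ltW.
  rewrite -[leRHS]mulr1; apply: ler_pM; rewrite ?invr_ge0 ?modulus_ge0 //.
    exact: modulus_stiff.
  by rewrite invf_le1.
have -> : modulus (h%:C ^+ 6 * l ^+ 3 / 192 * (stiff a c eps d z / te * X)) =
   modulus (l ^+ 3) / 192 *
     (modulus (stiff a c eps d z) * (h / modulus te * modulus X)) * h ^+ 5.
  rewrite modulusM4 modulus_h modulusV modulus_nat.
  rewrite [modulus (_ / te * _)]modulusM [modulus (_ / te)]modulusM modulusV.
  by field; rewrite gt_eqF.
rewrite ler_wpM2r ?exprn_ge0 ?(ltW h_gt0) //.
have h_te : h / modulus te <= 2 * eps.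
  rewrite ler_pdivrMr // -ler_pdivrMl ?mulr_gt0 // mulrC.
  exact: half_pivot_ge.
apply: ler_pM.
- by rewrite divr_ge0 ?modulus_ge0.
- by rewrite !mulr_ge0 ?invr_ge0 ?modulus_ge0 // ltW.
- by rewrite ler_wpM2r ?invr_ge0.
rewrite [2 * stiff_max]mulrC -[leRHS]mulrA; apply: ler_pM.
- exact: modulus_ge0.
- by rewrite !mulr_ge0 ?invr_ge0 ?modulus_ge0 // ltW.
- exact: modulus_stiff.
apply: (@le_trans _ _ (2 * eps * modulus X)).
  by rewrite ler_wpM2r ?modulus_ge0.
by rewrite -mulrA ler_wpM2l ?modulus_X.
Qed.

End Bounds.

(** * Arbitrary norms on matrices of size two *)

Section MatrixNorm.
Variables (R : realType) (N : 'M[R[i]]_2 -> R).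
Hypothesis normN : matrix_norm N.

Lemma matrix_norm_scale (x : R[i]) M : N (x *: M) = modulus x * N M.
Proof.
by apply: complexI; rewrite (matrix_normZ normN) modulusE rmorphM.
Qed.

Lemma matrix_norm_ge0 M : 0 <= N M.
Proof.
have N0 : N 0 = 0.
  by rewrite -[X in N X](scale0r 0) matrix_norm_scale /modulus normr0 /= mul0r.
have := matrix_normD normN M (-1 *: M).
rewrite matrix_norm_scale modulusN (modulus_nat _ 1) mul1r.
by rewrite scaleN1r subrr N0; lra.
Qed.

Definition unit_norms : R :=
  N (mx2 1 0 0 0) + N (mx2 0 1 0 0) + N (mx2 0 0 1 0) + N (mx2 0 0 0 1).

Lemma matrix_norm_mx2 x00 x01 x10 x11 (X : R) :
  modulus x00 <= X -> modulus x01 <= X -> modulus x10 <= X ->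
  modulus x11 <= X -> N (mx2 x00 x01 x10 x11) <= X * unit_norms.
Proof.
move=> b00 b01 b10 b11.
have -> : mx2 x00 x01 x10 x11 = x00 *: mx2 1 0 0 0 + x01 *: mx2 0 1 0 0
    + x10 *: mx2 0 0 1 0 + x11 *: mx2 0 0 0 1.
  by rewrite !mx2E; congr mx2; ring.
rewrite /unit_norms !mulrDr.
do 3 (apply: le_trans (matrix_normD normN _ _) _; apply: lerD;
  last by rewrite matrix_norm_scale ler_wpM2r ?matrix_norm_ge0).
by rewrite matrix_norm_scale ler_wpM2r ?matrix_norm_ge0.
Qed.

End MatrixNorm.

(** * The uniform local error *)

Theorem lemma5p4 (R : realType) (a c K eps0 h0 gamma : R)
    (N : 'M[R[i]]_2 -> R) :
  c ^+ 2 < a ^+ 2 -> 0 < K -> 0 < eps0 -> 0 < h0 -> 0 < gamma ->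
  matrix_norm N ->
  exists C C' : R, forall zeta : R -> R[i] -> R[i],
    zeta_branch a c K eps0 zeta ->
    (forall kappa eps : R, `|kappa| <= K -> 0 <= eps <= eps0 ->
       gamma%:C <= `|zeta eps ('i%C * kappa%:C)|) ->
    forall kappa eps h : R,
      `|kappa| <= K -> 0 < eps <= eps0 -> 0 < h <= h0 ->
      let d := 'i%C * kappa%:C in
      let z := zeta eps d in
      let Pi := Pi_s a c eps d z in
      let S := jxS a c h eps d in
      (exists q : R[i],
         [/\ Pi * S * Pi = q *: Pi,
             (forall q' : R[i], Pi * S * Pi = q' *: Pi -> q' = q) &
             `|q - cexp (h%:C * lambda_s a c eps d z)| <= (C * h ^+ 5)%:C])
      /\ N (Pi * S * Pi - mexp (h%:C *: jxL a c eps d) * Pi) <= C' * h ^+ 5.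
Proof.
move=> _ K_gt0 eps0_gt0 h0_gt0 gamma_gt0 normN.
pose M := lambda_max a c K eps0.
pose C := defect_max a c K eps0 h0 gamma + M ^+ 5 * expR (h0 * M).
pose w := coord1_max a c K eps0 gamma + eps0 * (K / gamma).
pose W := (1 + slope_max a c K eps0) * w.
exists C, (C * (W * unit_norms N)) => zeta zetaP zeta_ge kappa eps h kK.
move=> /andP[eps_gt0 eps_le] /andP[h_gt0 h_le] d z Pi S.
have epsI : 0 <= eps <= eps0 by rewrite ltW.
have z_ge : gamma <= modulus z by rewrite -lecR -modulusE; exact: zeta_ge.
have z_Re : 0 <= Re z by apply/ltW; exact: (zeta_Re_gt0 gamma_gt0 zetaP).
have disc : z ^+ 2 = 1 - 4 * eps%:C * c%:C * d
                     + 4 * eps%:C ^+ 2 * a%:C ^+ 2 * d ^+ 2.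
  by have [_ _] := zetaP _ kK; apply.
have z0 : z != 0 := gap_neq0 gamma_gt0 z_ge.
have z1 : 1 + z != 0 := disc_1z_neq0 z_Re.
have eps_neq0 : eps != 0 := lt0r_neq0 eps_gt0.
pose l := lambda_s a c eps d z.
pose q := jx_q a c eps d z h%:C.
have PSP : Pi * S * Pi = q *: Pi.
  apply: Pi_s_step => //; apply: modulus_gt0_neq0.
    by apply: lt_le_trans (half_pivot_ge _ _ _ _); rewrite ?divr_gt0 ?mulr_gt0.
  by apply: (lt_le_trans ltr01); case: (full_pivot_ge c kappa eps_gt0 h_gt0).
have l_le : modulus l <= M by exact: modulus_lambda_s.
have M_ge0 : 0 <= M := le_trans (modulus_ge0 _) l_le.
have q_exp : modulus (q - cexp (h%:C * l)) <= C * h ^+ 5.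
  rewrite -(subrKA (exp_taylor4 (h%:C * l))) /C mulrDl.
  apply: le_trans (ler_modulusD _ _) _; apply: lerD.
    exact: jx_q_taylor.
  rewrite -modulusN opprB; apply: le_trans (cexp_taylor4 _) _.
  rewrite modulusM modulus_real gtr0_norm // exprMn [h ^+ 5 * _]mulrC mulrAC.
  rewrite ler_wpM2r ?exprn_ge0 ?(ltW h_gt0) //.
  apply: ler_pM; rewrite ?exprn_ge0 ?modulus_ge0 ?expR_ge0 //.
    by rewrite lerXn2r ?nnegrE ?modulus_ge0.
  by rewrite ler_expR; apply: ler_pM; rewrite ?modulus_ge0 // ltW.
split.
  exists q; split=> // [q' PSP'|]; last by rewrite modulusE lecR.
  have Pi0 : Pi != 0 by exact: Pi_s_neq0.
  have : (q' - q) *: Pi = 0 by rewrite scalerBl -PSP' PSP subrr.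
  by move/eqP; rewrite scaler_eq0 (negPf Pi0) orbF subr_eq0 => /eqP.
have PP : Pi * Pi = Pi by exact: Pi_s_idem.
have -> : mexp (h%:C *: jxL a c eps d) * Pi = cexp (h%:C * l) *: Pi.
  rewrite (jxL_spectral eps_neq0 z0 z1 disc) -/l -/Pi.
  move: (Pi) PP => P PP; rewrite scalerDr !scalerA.
  exact: (mexp_spectral _ _ PP).
rewrite PSP -scalerBl (matrix_norm_scale normN) mulrAC.
apply: ler_pM; rewrite ?modulus_ge0 ?(matrix_norm_ge0 normN) //.
have c1 : modulus (coord1 a c eps d z) <= coord1_max a c K eps0 gamma.
  exact: modulus_coord1.
have c2 : modulus (coord2 eps d z) <= eps0 * (K / gamma).
  apply: (@le_trans _ _ (eps * (K / gamma))); first exact: modulus_coord2.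
  by rewrite ler_wpM2r // divr_ge0 // ltW.
have g : modulus (slope a c eps d z) <= slope_max a c K eps0.
  exact: modulus_slope.
have [c1_ge0 c2_ge0 g_ge0] : [/\ 0 <= coord1_max a c K eps0 gamma,
    0 <= eps0 * (K / gamma) & 0 <= slope_max a c K eps0].
  by split; [move: c1|move: c2|move: g]; apply: le_trans; exact: modulus_ge0.
rewrite /Pi Pi_s_rank1 //.
have wW x : modulus x <= w -> modulus x <= W.
  move=> /le_trans; apply; rewrite ler_peMl ?lerDl //.
  exact: addr_ge0.
have gW x : modulus x <= w -> modulus (slope a c eps d z * x) <= W.
  move=> xw; rewrite modulusM; apply: ler_pM; rewrite ?modulus_ge0 //.
  by rewrite (le_trans g) // lerDr.
have c1w : modulus (coord1 a c eps d z) <= w by rewrite (le_trans c1) ?lerDl.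
have c2w : modulus (coord2 eps d z) <= w by rewrite (le_trans c2) ?lerDr.
by apply: matrix_norm_mx2 => //; [exact: wW|exact: wW|exact: gW|exact: gW].
Qed.
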